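(* Let $\bm q$ be the bulk unresolved velocity and $\bm g$ the wall state, let $L$ be the lifting from wall states to the bulk space and $T=L^*$ the wall trace with $TL=I$, and let the fixed-geometry dynamics be $$\mathrm d\bm q=\bm f_q\,\mathrm dt+L\,\mathrm d\bm\Lambda_\Gamma,\qquad T\bm q=\bm g,\qquad M_\Gamma\,\mathrm d\bm g=-Z_\Gamma\bm g\,\mathrm dt+B_\Gamma\,\mathrm d\bm W_t-\mathrm d\bm\Lambda_\Gamma,$$ where $\mathrm d\bm\Lambda_\Gamma$ is the wall reaction impulse. Then the reaction enters the fluid and the wall with opposite signs, and its total power (the sum of the contribution $\langle\bm q,L\,\mathrm d\bm\Lambda_\Gamma\rangle$ to the fluid and the contribution $-\bm g\cdot\mathrm d\bm\Lambda_\Gamma$ to the wall) is $$(T\bm q-\bm g)\cdot\mathrm d\bm\Lambda_\Gamma=0 .$$ The physical boundary port is $\bm g\cdot\mathrm d\bm\Lambda_\Gamma$. The lifting term $\langle\bm q,L\,\mathrm d\bm g\rangle$ is a coordinate-inertia term and is not generally equal to the traction work $\bm g\cdot\mathrm d\bm\Lambda_\Gamma$.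
   Context: The bulk field is decomposed as $\bm q=N\bm z+L\bm g$, where $N$ maps homogeneous unresolved coordinates $\bm z$ into the bulk and $TN=0$. $L$ maps the wall space into the bulk inner product space, and $T=L^*$ is its adjoint. $M_\Gamma$ (positive), $Z_\Gamma$ and $B_\Gamma$ are the wall mass, wall impedance and wall noise amplitude; $\bm W_t$ is a vector Brownian motion; $\bm f_q$ is the bulk unresolved drift before reaction. $\langle\cdot,\cdot\rangle$ is the bulk inner product and $\cdot$ the wall inner product. *)

(* Defs.v *)
From HB Require Import structures.
From mathcomp Require Import all_boot all_order all_algebra.
From mathcomp Require Import all_classical all_reals all_analysis.

Set Implicit Arguments.
Unset Strict Implicit.
Unset Printing Implicit Defensive.
Import Order.TTheory GRing.Theory Num.Theory.
Import numFieldNormedType.Exports.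
Local Open Scope classical_set_scope.
Local Open Scope ring_scope.

(* Processes are maps from R to functions on the sample space; only the times
   t >= 0 are ever used. *)
Section processes.
Context (R : realType) (d : measure_display) (Om : measurableType d).

Definition filtration (F : R -> set (set Om)) : Prop :=
  [/\ forall t, 0 <= t -> sigma_algebra setT (F t),
      forall t, 0 <= t -> F t `<=` measurable
    & forall s t, 0 <= s -> s <= t -> F s `<=` F t].

Definition adapted (F : R -> set (set Om)) (X : R -> Om -> R) : Prop :=
  forall t, 0 <= t -> forall Y : set R, measurable Y -> F t (X t @^-1` Y).

Definition vadapted n (F : R -> set (set Om)) (X : R -> Om -> 'cV[R]_n) : Prop :=
  forall i, adapted F (fun t w => X t w i 0).

(* Standard k-dimensional Brownian motion for the filtration F. The last clause
   says at once that an increment over [s, t] is independent of F s, that its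
   components are independent, and that each of them is N(0, t - s) (the second
   parameter of normal_prob is the standard deviation). *)
Definition brownian_motion k (P : probability Om R) (F : R -> set (set Om))
    (W : R -> Om -> 'cV[R]_k) : Prop :=
  [/\ vadapted F W,
      forall w, W 0 w = 0,
      forall w i, {within `[0, +oo[, continuous (fun t => W t w i 0)}
    & forall s t, 0 <= s -> s < t ->
      forall (A : set Om) (Y : 'I_k -> set R), F s A ->
        (forall i, measurable (Y i)) ->
        P (A `&` [set w | forall i, Y i (W t w i 0 - W s w i 0)]) =
        (P A * \prod_(i < k) normal_prob 0 (Num.sqrt (t - s)) (Y i))%E].

(* A stochastic differential form is given by its (approximate) increments:
   D s t w is its increment over [s, t]. *)
Definition form := R -> R -> Om -> R.

Definition riemann_sum (D : form) (t : R) (p : seq R) (w : Om) : R :=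
  let u := nth t (0 :: p) in \sum_(0 <= i < size p) D (u i) (u i.+1) w.

Definition mesh_lt (eta t : R) (p : seq R) : Prop :=
  let u := nth t (0 :: p) in forall i, (i < size p)%N -> u i.+1 - u i < eta.

(* D and D' are the same stochastic differential: for all t >= 0, the Riemann
   sums of D - D' over the partitions of [0, t] tend to 0 in probability as the
   mesh tends to 0, i.e. D - D' has the stochastic integral 0 over [0, t].
   "In probability" is phrased with a measurable exceptional set E, so that the
   definition makes sense without measurability of the increments. *)
Definition same_differential (P : probability Om R) (D D' : form) : Prop :=
  forall t, 0 <= t -> forall eps delta : R, 0 < eps -> 0 < delta ->
  exists2 eta : R, 0 < eta &
    forall p : seq R, itv_partition 0 t p -> mesh_lt eta t p ->
    exists E : set Om, [/\ measurable E, (P E <= delta%:E)%E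
      & forall w, ~ E w -> `|riemann_sum D t p w - riemann_sum D' t p w| < eps].

(* The differential op(X, dY) with the integrand evaluated at the convex
   combination (1 - theta) X_s + theta X_t over [s, t]: theta = 0 is the Ito
   and theta = 1/2 the Stratonovich differential. *)
Definition pair_differential (V : lmodType R) (op : V -> V -> R) (theta : R)
    (X Y : R -> Om -> V) : form :=
  fun s t w => op ((1 - theta) *: X s w + theta *: X t w) (Y t w - Y s w).

End processes.

Section wall_fluid.
Context (R : realType) (d : measure_display) (Om : measurableType d).
Context (n k : nat) (H : lmodType R).
(* ip is the bulk inner product and wip the wall inner product *)
Context (ip : {dot H for idfun}) (wip : {dot 'cV[R]_n for idfun}).

Definition is_adjoint (L : 'cV[R]_n -> H) (T : H -> 'cV[R]_n) : Prop :=
  forall v x, ip v (L x) = wip (T v) x.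

(* Positive definiteness only: M need not be self-adjoint for wip. *)
Definition wall_positive (M : 'M[R]_n) : Prop :=
  forall x : 'cV[R]_n, x != 0 -> 0 < wip x (M *m x).

Notation mu := (@lebesgue_measure R).

Definition col_integral (s t : R) (x : R -> 'cV[R]_n) : 'cV[R]_n :=
  \col_i \int[mu]_(r in `[s, t]) x r i 0.

(* The integrated form of
     dq = fq dt + L dLam,  T q = g,  M dg = - Z g dt + B dW - dLam.
   The bulk space is an arbitrary inner product space, so the bulk equation is
   tested against every h; the noise is additive, so that no stochastic integral
   appears. *)
Definition wall_fluid_dynamics (P : probability Om R) (F : R -> set (set Om))
    (L : 'cV[R]_n -> H) (T : H -> 'cV[R]_n) (M Z : 'M[R]_n) (B : 'M[R]_(n, k))
    (W : R -> Om -> 'cV[R]_k) (fq q : R -> Om -> H) (g Lam : R -> Om -> 'cV[R]_n)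
    : Prop :=
  [/\ forall h, adapted F (fun t w => ip (fq t w) h),
      forall h, adapted F (fun t w => ip (q t w) h),
      vadapted F g,
      vadapted F Lam
    & {ae P, forall w,
        [/\ forall t h, 0 <= t ->
              mu.-integrable `[0, t] (fun r => (ip (fq r w) h)%:E),
            forall t i, 0 <= t ->
              mu.-integrable `[0, t] (fun r => (g r w i 0)%:E),
            forall s t h, 0 <= s -> s <= t ->
              ip (q t w - q s w) h =
              \int[mu]_(r in `[s, t]) ip (fq r w) h + ip (L (Lam t w - Lam s w)) h,
            forall t, 0 <= t -> T (q t w) = g t w
          & forall s t, 0 <= s -> s <= t ->
              M *m (g t w - g s w) =
              - (Z *m col_integral s t (g ^~ w)) + B *m (W t w - W s w)
              - (Lam t w - Lam s w)]}].

(* Reaction impulse received by the fluid over [s, t] (tested against h): the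
   part of the momentum change which is not due to the drift fq. *)
Definition fluid_reaction (fq q : R -> Om -> H) (s t : R) (h : H) (w : Om) : R :=
  ip (q t w - q s w) h - \int[mu]_(r in `[s, t]) ip (fq r w) h.

(* Reaction impulse received by the wall over [s, t]: the part of the momentum
   change which is due neither to the impedance nor to the noise. *)
Definition wall_reaction (M Z : 'M[R]_n) (B : 'M[R]_(n, k))
    (W : R -> Om -> 'cV[R]_k) (g : R -> Om -> 'cV[R]_n) (s t : R) (w : Om)
    : 'cV[R]_n :=
  M *m (g t w - g s w) + Z *m col_integral s t (g ^~ w) - B *m (W t w - W s w).

(* <q, L dLam> *)
Definition fluid_power theta (L : 'cV[R]_n -> H) (q : R -> Om -> H)
    (Lam : R -> Om -> 'cV[R]_n) : form R Om :=
  pair_differential ip theta q (fun t w => L (Lam t w)).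

(* - g . dLam *)
Definition wall_power theta (g Lam : R -> Om -> 'cV[R]_n) : form R Om :=
  fun s t w => - pair_differential wip theta g Lam s t w.

(* g . dLam *)
Definition boundary_port theta (g Lam : R -> Om -> 'cV[R]_n) : form R Om :=
  pair_differential wip theta g Lam.

(* <q, L dg> *)
Definition lifting_term theta (L : 'cV[R]_n -> H) (q : R -> Om -> H)
    (g : R -> Om -> 'cV[R]_n) : form R Om :=
  pair_differential ip theta q (fun t w => L (g t w)).

(* The contribution <q, L dg> of the coordinate g to the inertia differential
   <q, dq> in the coordinates q = N z + L g (with T N = 0). *)
Definition coordinate_inertia (P : probability Om R) theta
    (L : 'cV[R]_n -> H) (T : H -> 'cV[R]_n) (q : R -> Om -> H)
    (g : R -> Om -> 'cV[R]_n) : Prop :=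
  forall (U : lmodType R) (N : {linear U -> H}) (z : R -> Om -> U),
    (forall u, T (N u) = 0) ->
    {ae P, forall w, forall t, 0 <= t -> q t w = N (z t w) + L (g t w)} ->
    same_differential P (pair_differential ip theta q q)
      (fun s t w => pair_differential ip theta q (fun t w => N (z t w)) s t w +
                    lifting_term theta L q g s t w).

End wall_fluid.

(* Main.v *)
(* The power identities hold path by path, since [<q, L x> = T q . x]; the
   constraint [T q = g] then kills the total power.
   For the counterexample take [q = L g] and a bulk drift [L f]: the constraint
   forces [dg - dLam = f dt], so that the two terms differ by [g . f dt]. The
   wall equation becomes [(M + 1) dg = (f - Z g) dt + B dW], which
   [g = (M + 1)^-1 B W + (1 + c t) v] solves with [f = Z g + c (M + 1) v]; the
   constant [c] is chosen so that [g . f = 1] at time 0, hence [g . f >= 1/2] on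
   a random initial interval, on which every Riemann sum of [g . f dt] is bounded
   below. *)
Require Import Defs.
From HB Require Import structures.
From mathcomp Require Import all_boot all_order all_algebra.
From mathcomp Require Import all_classical all_reals all_analysis.
From mathcomp Require Import ring lra.
Import Order.TTheory GRing.Theory Num.Theory.
Import numFieldNormedType.Exports.
Local Open Scope classical_set_scope.
Local Open Scope ring_scope.

Set Implicit Arguments.
Unset Strict Implicit.
Unset Printing Implicit Defensive.

Lemma dotC (R : realType) (U : lmodType R) (f : {dot U for idfun}) x y :
  f x y = f y x.
Proof. by rewrite (hermC f) /= expr0 mul1r. Qed.

(** * Riemann sums over partitions of [[0, t]] *)

Section RiemannSums.
Context (R : realType) (d : measure_display) (Om : measurableType d).
Implicit Types (D : Defs.form R Om) (P : probability Om R).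

Lemma itv_partition_nth_leS (t : R) p i : itv_partition 0 t p ->
  (i < size p)%N -> nth t (0 :: p) i <= nth t (0 :: p) i.+1.
Proof. by move=> [/(pathP t) + _] ip => /(_ i ip) /ltW. Qed.

(** A measurable null set off which the increments agree serves as the exceptional set for all [eps]
    and [delta]; off it the Riemann sums coincide, so any mesh bound will do. *)
Lemma same_differential_ae P D D' :
  {ae P, forall w, forall s t, 0 <= s -> s <= t -> D s t w = D' s t w} ->
  same_differential P D D'.
Proof.
move=> [E [mE PE0 sE]] t t0 eps delta e0 d0; exists 1 => // p tp _.
exists E; split => //; first by rewrite PE0 lee_fin ltW.
move=> w /(contra_not (sE w))/contrapT eqD.
rewrite (_ : riemann_sum D t p w = riemann_sum D' t p w) ?subrr ?normr0 //.
apply: eq_big_nat => i /andP[_ ip]; apply: eqD.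
  exact: (itv_partition_nth_ge (ltnW ip) tp).
exact: itv_partition_nth_leS.
Qed.

(** The lengths [u - s] of the cells telescope to [t], whatever the mesh. *)
Lemma riemann_sum_ge D (c t : R) p w : itv_partition 0 t p ->
  (forall s u, 0 <= s -> s <= u -> u <= t -> c * (u - s) <= D s u w) ->
  c * t <= riemann_sum D t p w.
Proof.
move=> tp Dge; rewrite /riemann_sum.
have -> : c * t = \sum_(0 <= i < size p)
    c * (nth t (0 :: p) i.+1 - nth t (0 :: p) i).
  by rewrite -mulr_sumr telescope_sumr // (itv_partition_nth_size _ tp) subr0.
apply: ler_sum_nat => i /andP[_ ip]; apply: Dge.
- exact: (itv_partition_nth_ge (ltnW ip) tp).
- exact: itv_partition_nth_leS.
- exact: itv_partition_nth_le.
Qed.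

(** A claim about all partitions of small mesh can be refuted only on an actual one; the uniform
    grid provides it. *)
Lemma itv_partition_mesh_lt (eta t : R) : 0 < eta -> 0 < t ->
  exists2 p : seq R, itv_partition 0 t p & mesh_lt eta t p.
Proof.
(* [N + 1] exceeds [t / eta], so the step [t / (N + 1)] is below [eta]. *)
move=> eta0 t0; pose N := (Num.truncn (t / eta)).
pose x (i : nat) : R := t * i%:R / N.+1%:R.
have N0 : 0 < N.+1%:R :> R by [].
have xS i : x i.+1 - x i = t / N.+1%:R.
  by rewrite /x -mulrBl -mulrBr -natrB // subSnn mulr1.
pose p := mkseq (x \o succn) N.+1.
have nthx i : (i <= N.+1)%N -> nth t (0 :: p) i = x i.
  case: i => [_|i iN]; first by rewrite /= /x mulr0 mul0r.
  by rewrite -[LHS]/(nth t p i) nth_mkseq.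
have sp : size p = N.+1 by rewrite size_mkseq.
exists p.
  split.
    apply/(pathP t) => i; rewrite sp => iN.
    rewrite -[nth t p i]/(nth t (0 :: p) i.+1).
    by rewrite (nthx i.+1) // (nthx i) 1?ltnW // -subr_gt0 xS divr_gt0.
  by apply/eqP; rewrite (last_nth t) sp nthx // /x mulfK ?gt_eqF.
rewrite /mesh_lt => i; rewrite sp => iN.
rewrite (nthx i.+1) // (nthx i) 1?ltnW // xS.
rewrite ltr_pdivrMr // mulrC -ltr_pdivrMr //.
exact: truncnS_gt.
Qed.

End RiemannSums.

(** * Integrals of continuous functions as limits of Riemann sums *)

Section ContinuousIntegrals.
Context (R : realType).
Implicit Types (f : R -> R) (s t : R).
Notation mu := (@lebesgue_measure R).

Lemma integrable_continuous f s t : continuous f ->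
  mu.-integrable `[s, t] (EFin \o f).
Proof.
move=> cf; apply: continuous_compact_integrable; first exact: segment_compact.
exact: continuous_subspaceT.
Qed.

(** The subtraction leaves a half-open interval; adding its endpoint [s] changes nothing, a point
    being a null set. *)
Lemma Rintegral_itvDB f s t : continuous f -> 0 <= s -> s <= t ->
  \int[mu]_(r in `[0, t]) f r - \int[mu]_(r in `[0, s]) f r =
  \int[mu]_(r in `[s, t]) f r.
Proof.
move=> cf s0 st; rewrite Rintegral_itvB ?bnd_simp //; last exact: integrable_continuous.
rewrite Rintegral_itv_obnd_cbnd //.
apply: (@integrableS _ _ _ mu `[s, t]%classic) => //.
  exact: subset_itv_oc_cc.
exact: integrable_continuous.
Qed.

Lemma Rintegral_itv_cst (c s t : R) : s <= t ->
  \int[mu]_(r in `[s, t]) c = (t - s) * c.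
Proof.
move=> st; rewrite Rintegral_cst //= lebesgue_measure_itv /= lte_fin mulrC.
by case: ltgtP st => [||->] // _; last rewrite subrr fine0 !mul0r.
Qed.

(** Heine-Cantor, with [y] free to leave the interval. Compactness in its near-covering form, with
    the radius [dl] as parameter, turns the local radii into a common one. *)
Lemma uniform_continuity_itv f (t eps : R) : continuous f -> 0 < eps ->
  exists2 delta, 0 < delta & forall x y, x \in `[0, t] ->
    `|x - y| < delta -> `|f x - f y| < eps.
Proof.
move=> cf e0.
have /compact_near_coveringP : compact `[0, t]%classic by exact: segment_compact.
move=> /(_ R (0^'+)%R (fun dl x => forall y, `|x - y| < dl -> `|f x - f y| < eps)) H.
have {}H : \forall dl \near 0^'+, `[0, t]%classic `<=`
   (fun x => forall y, `|x - y| < dl -> `|f x - f y| < eps).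
  apply: H => x _.
  have /cvgrPdist_lt /(_ (eps / 2)) := cf x; rewrite divr_gt0// => /(_ isT).
  move=> /nbhs_ballP[e /= egt0 Pe].
  near=> z dl => y zy.
  have fz : `|f x - f z| < eps / 2.
    apply: Pe; rewrite /ball /=; near: z.
    exact: (@cvgr_dist_lt _ _ _ _ _ id x).
  have fy : `|f x - f y| < eps / 2.
    apply: Pe; rewrite /ball /=.
    have xz : `|x - z| < e / 2.
      near: z.
      by apply: (@cvgr_dist_lt _ _ _ _ _ id x) => //; rewrite divr_gt0.
    have de : dl < e / 2 by near: dl; apply: nbhs_right_lt; rewrite divr_gt0.
    rewrite (le_lt_trans (ler_distD z _ _))// [ltRHS]splitr ltrD//.
    exact: lt_trans zy de.
  rewrite (le_lt_trans (ler_distD (f x) _ _))// [ltRHS]splitr ltrD//.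
  by rewrite distrC.
have [dl [dl0 Hd]] : exists dl, 0 < dl /\ `[0, t]%classic `<=`
   (fun x => forall y, `|x - y| < dl -> `|f x - f y| < eps).
  have : \forall dl \near 0^'+, 0 < dl /\ `[0, t]%classic `<=`
    (fun x => forall y, `|x - y| < dl -> `|f x - f y| < eps).
    near=> dl; split; near: dl => //; exact: nbhs_right_gt.
  exact: filter_ex.
by exists dl => // x y xt; apply: Hd; rewrite set_itvE in xt *.
Unshelve. all: by end_near. Qed.

(** By monotonicity the integral lies between those of the constants [f s - e] and [f s + e]. *)
Lemma Rintegral_itv_near_cst f (s t e : R) : continuous f -> s <= t ->
  (forall r, s <= r <= t -> `|f s - f r| <= e) ->
  `|(t - s) * f s - \int[mu]_(r in `[s, t]) f r| <= (t - s) * e.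
Proof.
move=> cf st fe; have ic c := @integrable_continuous (cst c) s t (@cst_continuous _ _ c).
rewrite ler_distlC -mulrBr -mulrDr -!Rintegral_itv_cst //.
apply/andP; split; apply: le_Rintegral => //= ; try exact: integrable_continuous;
  try exact: ic.
  move=> r; rewrite in_itv /= => /fe; rewrite ler_distlC; lra.
move=> r; rewrite in_itv /= => /fe; rewrite ler_distlC; lra.
Qed.

Lemma riemann_sum_cvg f t : continuous f -> 0 <= t ->
  (fun N => \sum_(0 <= i < N.+1) t / N.+1%:R * f (t * i%:R / N.+1%:R)) @ \oo
  --> \int[mu]_(r in `[0, t]) f r.
Proof.
move=> cf t0; apply/cvgrPdist_lt => eps e0.
(* Dividing by [t + 1] rather than [t] covers [t = 0] and makes the total error [eps * t / (t + 1)]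
   strictly less than [eps]. *)
have e1 : 0 < eps / (t + 1) by rewrite divr_gt0 // ltr_wpDl.
have [dl dl0 fdl] := uniform_continuity_itv t cf e1.
exists (Num.truncn (t / dl)) => // N /= leN.
have N0 : 0 < N.+1%:R :> R by [].
have tN : t / N.+1%:R < dl.
  rewrite ltr_pdivrMr // mulrC -ltr_pdivrMr // (lt_le_trans (truncnS_gt _)) //.
  by rewrite ler_nat.
pose x (i : nat) : R := t * i%:R / N.+1%:R.
have xS i : x i.+1 - x i = t / N.+1%:R.
  by rewrite /x -mulrBl -mulrBr -natrB // subSnn mulr1.
have x0 i : 0 <= x i by rewrite /x divr_ge0 // mulr_ge0.
have xi i : x i <= x i.+1 by rewrite -subr_ge0 xS divr_ge0.
have xt i : (i <= N.+1)%N -> x i <= t.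
  move=> iN; rewrite /x ler_pdivrMr // ler_wpM2l // ler_nat //.
(* The primitive [G] telescopes along the grid, so the error can be estimated cell by cell. *)
pose G y := \int[mu]_(r in `[0, y]) f r.
have -> : \int[mu]_(r in `[0, t]) f r = \sum_(0 <= i < N.+1) (G (x i.+1) - G (x i)).
  rewrite telescope_sumr // /G {1}/x mulfK ?gt_eqF // /x mulr0 mul0r.
  by rewrite set_itv1 Rintegral_set1 subr0.
rewrite -sumrB (le_lt_trans (ler_norm_sum _ _ _)) //.
apply: (@le_lt_trans _ _ (\sum_(0 <= i < N.+1) (t / N.+1%:R) * (eps / (t + 1)))).
  apply: ler_sum_nat => i /andP[_ iN].
  rewrite distrC /G Rintegral_itvDB // -(xS i) -/(x i).
  apply: Rintegral_itv_near_cst => // r /andP[xr rx]; rewrite ltW // fdl //.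
    by rewrite in_itv /= x0 xt // ltnW.
  rewrite (le_lt_trans _ tN) // -(xS i) distrC ger0_norm ?subr_ge0 //.
  by rewrite lerB.
have t1 : t + 1 != 0 by rewrite gt_eqF // ltr_wpDl.
rewrite sumr_const_nat subn0 -[X in X < _]mulr_natr.
have -> : t / N.+1%:R * (eps / (t + 1)) * N.+1%:R = eps * (t / (t + 1)).
  by field; rewrite t1 nat1r pnatr_eq0.
by rewrite -[X in _ < X]mulr1 ltr_pM2l // ltr_pdivrMr ?mul1r ?ltrDl // ltr_wpDl.
Qed.

End ContinuousIntegrals.

(** * Closure properties of adapted processes *)

Section Adapted.
Context (R : realType) (d : measure_display) (Om : measurableType d).
Context (F : R -> set (set Om)) (hF : filtration F).
Implicit Types (X Y : R -> Om -> R) (n m : nat).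
Notation mu := (@lebesgue_measure R).

(** Generating from [G], already a sigma-algebra, adds no sets. Adaptedness thus becomes
    measurability for a measurable type built on [G] and inherits the closure properties of
    measurable functions. *)
Lemma sigma_algebra_preimageP (G : set (set Om)) (f : Om -> R) :
  sigma_algebra setT G ->
  (forall Y : set R, measurable Y -> G (f @^-1` Y)) <->
  measurable_fun setT (f : g_sigma_algebraType G -> R).
Proof.
move=> sG; split=> [fG _ Y mY|fG Y mY].
  by rewrite setTI; apply: sub_gen_smallest; exact: fG.
by have := fG measurableT Y mY; rewrite setTI -[X in X -> _]/(<<s G >> _) sigma_algebra_id.
Qed.

Lemma adaptedP X : adapted F X <->
  forall t, 0 <= t -> measurable_fun setT (X t : g_sigma_algebraType (F t) -> R).
Proof.
have [sF _ _] := hF.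
by split=> aX t t0; apply/sigma_algebra_preimageP; [exact: sF|exact: aX|exact: sF|exact: aX].
Qed.

Lemma adapted_cst (x : R -> R) : adapted F (fun t _ => x t).
Proof. by apply/adaptedP => t t0; exact: measurable_cst. Qed.

Lemma adaptedD X Y : adapted F X -> adapted F Y ->
  adapted F (fun t w => X t w + Y t w).
Proof.
move=> /adaptedP aX /adaptedP aY; apply/adaptedP => t t0.
by apply: measurable_realfun.measurable_funD; [exact: aX|exact: aY].
Qed.

Lemma adaptedZ (x : R) X : adapted F X -> adapted F (fun t w => x * X t w).
Proof.
move=> /adaptedP aX; apply/adaptedP => t t0.
by apply: measurable_realfun.measurable_funM; [exact: measurable_cst|exact: aX].
Qed.

Lemma adapted_sum (I : Type) (s : seq I) (X : I -> R -> Om -> R) :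
  (forall i, adapted F (X i)) -> adapted F (fun t w => \sum_(i <- s) X i t w).
Proof.
move=> aX; apply/adaptedP => t t0; apply: measurable_sum => i.
by have /adaptedP := aX i; apply.
Qed.

(** The integral is a pointwise limit of Riemann sums that sample [X] at times up to [t] only, hence
    of [F t]-measurable functions. *)
Lemma adapted_Rintegral X : adapted F X -> (forall w, continuous (X ^~ w)) ->
  adapted F (fun t w => \int[mu]_(r in `[0, t]) X r w).
Proof.
move=> aX cX; have [sF _ mono] := hF; apply/adaptedP => t t0.
(* Measurability of the sum is asked term by term for every index [i], in range or not;
   [minn i N.+1] keeps the sample time at most [t] and changes no term that occurs. *)
apply: (@measurable_realfun.measurable_fun_cvg _ _ _ _
  (fun N (w : g_sigma_algebraType (F t)) =>
     \sum_(0 <= i < N.+1) t / N.+1%:R * X (t * (minn i N.+1)%:R / N.+1%:R) w)).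
  move=> N; apply: measurable_sum => i; apply: measurable_realfun.measurable_funM => //.
  apply/sigma_algebra_preimageP; first exact: sF.
  move=> Y mY.
  have x0 : 0 <= t * (minn i N.+1)%:R / N.+1%:R by rewrite divr_ge0 // mulr_ge0.
  apply: (mono _ _ x0); last exact: aX.
  by rewrite ler_pdivrMr // ler_wpM2l // ler_nat geq_minr.
move=> w _; have := riemann_sum_cvg (cX w) t0.
apply: cvg_trans; apply: near_eq_cvg; near=> N.
by apply: eq_big_nat => i /andP[_ /ltnW/minn_idPl ->].
Unshelve. all: by end_near. Qed.

Lemma vadapted_cst n (x : R -> 'cV[R]_n) : vadapted F (fun t _ => x t).
Proof. by move=> i; exact: adapted_cst. Qed.

Lemma vadaptedD n (X Y : R -> Om -> 'cV[R]_n) : vadapted F X -> vadapted F Y ->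
  vadapted F (fun t w => X t w + Y t w).
Proof.
move=> aX aY i; rewrite (_ : (fun _ => _) = fun t w => X t w i 0 + Y t w i 0).
  exact: adaptedD.
by apply/funext => t; apply/funext => w; rewrite mxE.
Qed.

Lemma vadapted_mulmx m n (A : 'M[R]_(m, n)) (X : R -> Om -> 'cV[R]_n) :
  vadapted F X -> vadapted F (fun t w => A *m X t w).
Proof.
move=> aX i; rewrite (_ : (fun _ => _) = fun t w => \sum_j A i j * X t w j 0).
  by apply: adapted_sum => j; exact: adaptedZ.
by apply/funext => t; apply/funext => w; rewrite mxE.
Qed.

Lemma vadapted_col_integral n (X : R -> Om -> 'cV[R]_n) : vadapted F X ->
  (forall w i, continuous (fun r => X r w i 0)) ->
  vadapted F (fun t w => col_integral 0 t (X ^~ w)).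
Proof.
move=> aX cX i.
rewrite (_ : (fun _ => _) = fun t w => \int[mu]_(r in `[0, t]) X r w i 0).
  by apply: adapted_Rintegral.
by apply/funext => t; apply/funext => w; rewrite mxE.
Qed.

End Adapted.

(** * Coordinatewise integrals of vector paths *)

Section ColIntegral.
Context (R : realType).
Notation mu := (@lebesgue_measure R).
Implicit Types s t : R.

Lemma continuous_sum_seq (I : Type) (l : seq I) (f : I -> R -> R) :
  (forall i, continuous (f i)) -> continuous (fun r => \sum_(i <- l) f i r).
Proof. by move=> cf r; apply: cvg_big => [|i _]; [exact: add_continuous|exact: cf]. Qed.

Lemma continuous_scale (a : R) (f : R -> R) :
  continuous f -> continuous (fun r => a * f r).
Proof. by move=> cf r; apply: cvgM; [exact: cvg_cst|exact: cf]. Qed.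

Lemma Rintegral_sum (I : Type) (l : seq I) (f : I -> R -> R) s t :
  (forall i, continuous (f i)) ->
  \int[mu]_(r in `[s, t]) (\sum_(i <- l) f i r) =
  \sum_(i <- l) \int[mu]_(r in `[s, t]) f i r.
Proof.
move=> cf; elim: l => [|i l IHl].
  rewrite big_nil (@eq_Rintegral _ _ _ mu _ (cst 0)) => [|r _]; last by rewrite big_nil.
  by rewrite Rintegral_cst // mul0r.
rewrite big_cons -IHl -RintegralD //; last 2 first.
- exact: integrable_continuous.
- by apply: integrable_continuous; exact: continuous_sum_seq.
by apply: eq_Rintegral => r _; rewrite big_cons.
Qed.

Lemma Rintegral_lincomb n (a : 'I_n -> R) (x : R -> 'cV[R]_n) s t :
  (forall i, continuous (fun r => x r i 0)) ->
  \int[mu]_(r in `[s, t]) (\sum_i a i * x r i 0) =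
  \sum_i a i * col_integral s t x i 0.
Proof.
move=> cx; rewrite Rintegral_sum => [|i]; last exact: continuous_scale.
apply: eq_bigr => i _; rewrite RintegralZl // ?mxE //.
exact: integrable_continuous.
Qed.

Lemma col_integralDB n (x : R -> 'cV[R]_n) s t :
  (forall i, continuous (fun r => x r i 0)) -> 0 <= s -> s <= t ->
  col_integral 0 t x - col_integral 0 s x = col_integral s t x.
Proof. by move=> cx s0 st; apply/colP => i; rewrite !mxE Rintegral_itvDB. Qed.

Lemma continuous_affine m n (A : 'M[R]_(m, n)) (b : 'cV[R]_m) (x : R -> 'cV[R]_n) :
  (forall i, continuous (fun r => x r i 0)) ->
  forall i, continuous (fun r => (A *m x r + b) i 0).
Proof.
move=> cx i.
rewrite (_ : (fun _ => _) = (fun r => \sum_j A i j * x r j 0 + b i 0)).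
  move=> r; apply: cvgD; last exact: cvg_cst.
  by apply: continuous_sum_seq => j; exact: continuous_scale.
by apply/funext => r; rewrite !mxE.
Qed.

(** Meant for the drift of the counterexample, an affine function of [g] with matrix [Z]. *)
Lemma col_integral_affine m n (A : 'M[R]_(m, n)) (b : 'cV[R]_m)
    (x : R -> 'cV[R]_n) s t :
  (forall i, continuous (fun r => x r i 0)) -> s <= t ->
  col_integral s t (fun r => A *m x r + b) = A *m col_integral s t x + (t - s) *: b.
Proof.
move=> cx st; apply/colP => i; rewrite mxE.
rewrite (@eq_Rintegral _ _ _ mu _ (fun r => \sum_j A i j * x r j 0 + b i 0)); last first.
  by move=> r _; rewrite !mxE.
rewrite RintegralD ?Rintegral_lincomb ?Rintegral_itv_cst ?mxE //.
  apply: integrable_continuous; apply: continuous_sum_seq => j.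
  exact: continuous_scale.
by apply: integrable_continuous; exact: cst_continuous.
Qed.

(** The wall inner product is arbitrary, so coordinates enter with the weights [f a (delta_mx i 0)];
    continuity and integration of [f a (x r)] reduce to scalar paths. *)
Lemma dot_colE n (f : {dot 'cV[R]_n for idfun}) (a x : 'cV[R]_n) :
  f a x = \sum_i f a (delta_mx i 0) * x i 0.
Proof.
rewrite {1}[x]matrix_sum_delta linear_sumr /=; apply: eq_bigr => i _.
by rewrite big_ord1 linearZr_LR /= mulrC.
Qed.

Lemma continuous_dot n (f : {dot 'cV[R]_n for idfun}) (a : 'cV[R]_n)
    (x : R -> 'cV[R]_n) :
  (forall i, continuous (fun r => x r i 0)) -> continuous (fun r => f a (x r)).
Proof.
move=> cx; rewrite (_ : (fun _ => _) =
    fun r => \sum_i f a (delta_mx i 0) * x r i 0).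
  by apply: continuous_sum_seq => i; exact: continuous_scale.
by apply/funext => r; exact: dot_colE.
Qed.

Lemma Rintegral_dot n (f : {dot 'cV[R]_n for idfun}) (a : 'cV[R]_n)
    (x : R -> 'cV[R]_n) s t :
  (forall i, continuous (fun r => x r i 0)) ->
  \int[mu]_(r in `[s, t]) f a (x r) = f a (col_integral s t x).
Proof.
move=> cx; rewrite dot_colE -Rintegral_lincomb //.
by apply: eq_Rintegral => r _; exact: dot_colE.
Qed.

End ColIntegral.

(** * Action-reaction and the power identities *)

Section Reaction.
Context (R : realType) (d : measure_display) (Om : measurableType d).
Context (P : probability Om R) (F : R -> set (set Om)) (n k : nat).
Context (W : R -> Om -> 'cV[R]_k) (H : lmodType R).
Context (ip : {dot H for idfun}) (wip : {dot 'cV[R]_n for idfun}).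
Context (L : {linear 'cV[R]_n -> H}) (T : {linear H -> 'cV[R]_n}).
Context (M Z : 'M[R]_n) (B : 'M[R]_(n, k)).
Context (hT : is_adjoint ip wip L T).

Lemma dot_lift x (h : H) : ip (L x) h = wip (T h) x.
Proof. by rewrite dotC hT. Qed.

Lemma fluid_powerE theta q (Lam : R -> Om -> 'cV[R]_n) s t w :
  fluid_power ip theta L q Lam s t w =
  wip ((1 - theta) *: T (q s w) + theta *: T (q t w)) (Lam t w - Lam s w).
Proof.
by rewrite /fluid_power /pair_differential -linearB hT (linearD T) !linearZ_LR.
Qed.

Lemma total_powerE theta q g (Lam : R -> Om -> 'cV[R]_n) s t w :
  fluid_power ip theta L q Lam s t w + wall_power wip theta g Lam s t w =
  pair_differential wip theta (fun t w => T (q t w) - g t w) Lam s t w.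
Proof.
rewrite fluid_powerE /wall_power /pair_differential -linearBl /=; congr (wip _ _).
by rewrite !scalerBr opprD addrACA.
Qed.

Context (fq q : R -> Om -> H) (g Lam : R -> Om -> 'cV[R]_n).
Context (dyn : wall_fluid_dynamics ip P F L T M Z B W fq q g Lam).

(** Each reaction is the residual of its own momentum equation: the bulk leaves [L] applied to the
    increment of [Lam], the wall leaves minus that increment. *)
Lemma action_reaction :
  {ae P, forall w, forall s t h, 0 <= s -> s <= t ->
     fluid_reaction ip fq q s t h w = - ip (L (wall_reaction M Z B W g s t w)) h}.
Proof.
case: dyn => _ _ _ _; apply: filterS => w [_ _ bulk _ wall] s t h s0 st.
rewrite /fluid_reaction bulk // addrC addKr.
have -> : wall_reaction M Z B W g s t w = - (Lam t w - Lam s w).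
  rewrite /wall_reaction wall //; move: (Z *m _) (B *m _) (Lam t w - _) => X Y D.
  by apply/colP => i; rewrite !mxE; ring.
by rewrite linearN linearNl opprK.
Qed.

Lemma ae_trace : {ae P, forall w, forall t, 0 <= t -> T (q t w) = g t w}.
Proof. by case: dyn => _ _ _ _; apply: filterS => w []. Qed.

Lemma fluid_power_port theta : same_differential P
  (fluid_power ip theta L q Lam) (boundary_port wip theta g Lam).
Proof.
apply: same_differential_ae; apply: filterS ae_trace => w Tq s t s0 st.
by rewrite fluid_powerE !Tq // (le_trans s0).
Qed.

Lemma trace_power0 theta : same_differential P
  (pair_differential wip theta (fun t w => T (q t w) - g t w) Lam)
  (fun _ _ _ => 0).
Proof.
apply: same_differential_ae; apply: filterS ae_trace => w Tq s t s0 st.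
by rewrite /pair_differential !Tq ?(le_trans s0) // !subrr !scaler0 addr0 linear0l.
Qed.

(** The increment of [q] splits as [N dz + L dg], and the pairing with the common integrand is
    linear in it. *)
Lemma coordinate_inertia_lifting theta : coordinate_inertia ip P theta L T q g.
Proof.
move=> U N z _ qE; apply: same_differential_ae; apply: filterS qE => w qE s t s0 st.
rewrite /lifting_term /pair_differential -linearDr /=; congr (ip _ _).
by rewrite !qE ?(le_trans s0) // opprD addrACA.
Qed.

End Reaction.

(** * A solution whose lifting term differs from the boundary port *)

Section LiftingCounterexample.
Context (R : realType) (d : measure_display) (Om : measurableType d).
Context (P : probability Om R) (F : R -> set (set Om)) (n k : nat).
Context (W : R -> Om -> 'cV[R]_k) (H : lmodType R).
Context (ip : {dot H for idfun}) (wip : {dot 'cV[R]_n for idfun}).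
Context (L : {linear 'cV[R]_n -> H}) (T : {linear H -> 'cV[R]_n}).
Context (M Z : 'M[R]_n) (B : 'M[R]_(n, k)).
Context (hF : filtration F) (hW : brownian_motion P F W).
Context (hT : is_adjoint ip wip L T) (hTL : forall x, T (L x) = x).
Context (hM : wall_positive wip M) (v : 'cV[R]_n) (v0 : v != 0).
Notation mu := (@lebesgue_measure R).

(** The fluid motion [L g] adds the inertia [L^* L = T L = 1] to the wall mass. *)
Let K := M + 1%:M.
Let c := (1 - wip v (Z *m v)) / wip v (K *m v).
(** Paths of [W] are continuous on [[0, +oo[]; freezing them at negative times gives continuity on
    the whole line, as the integration lemmas ask. *)
Let W' t w := W (Num.max 0 t) w.
Let g t w := (invmx K *m B) *m W' t w + (1 + c * t) *: v.
Let f t w := Z *m g t w + c *: (K *m v).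
(** The wall equation solved for the reaction: it holds by construction, and the bulk equation
    remains to be checked. *)
Let Lam t w := B *m W' t w - M *m g t w - Z *m col_integral 0 t (g ^~ w).

Let K_gt0 x : x != 0 -> 0 < wip x (K *m x).
Proof.
move=> x0; rewrite mulmxDl mul1mx linearDr /= addr_gt0 ?hM //.
exact: neq0_dnorm_gt0.
Qed.

(** A row in the left kernel of [K^T] transposes to some [x] with [K *m x = 0], and positivity
    forces [x = 0]. *)
Let K_unit : K \in unitmx.
Proof.
rewrite -unitmx_tr -row_free_unit -kermx_eq0; apply/eqP/row_matrixP => i.
rewrite row0; apply/eqP/negPn/negP => r0.
have /K_gt0 : (row i (kermx K^T))^T != 0 by rewrite trmx_eq0.
rewrite -{2}[K]trmxK -trmx_mul.
have /sub_kermxP -> := row_sub i (kermx K^T).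
by rewrite trmx0 linear0r ltxx.
Qed.

Let W'_cont w i : continuous (fun r => W' r w i 0).
Proof.
have [_ _ /(_ w i)/subspace_continuousP cW _] := hW => r.
have max_ge x : `[0, +oo[%classic (Num.max 0 x : R).
  by rewrite /= in_itv /= le_max lexx.
apply: cvg_trans (cW _ (max_ge r)) => Q /= wQ.
have cmax : continuous (fun x : R => Num.max 0 x).
  apply: max_fun_continuous; [exact: cst_continuous|by move=> x; exact: cvg_id].
have := cmax r _ wQ.
by apply: (@filterS _ (nbhs r)) => x; apply; exact: max_ge.
Qed.

Let W'_adapted : vadapted F W'.
Proof.
have [aW _ _ _] := hW => i t t0 Y mY; rewrite /W' max_r //; exact: aW.
Qed.

Let g_cont w i : continuous (fun r => g r w i 0).
Proof.
rewrite (_ : (fun _ => _) = fun r =>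
    (invmx K *m B *m W' r w + 0) i 0 + (1 + c * r) * v i 0).
  move=> r; apply: cvgD.
    by apply: continuous_affine => j; exact: W'_cont.
  apply: cvgM; last exact: cvg_cst.
  by apply: cvgD; [exact: cvg_cst|apply: cvgM; [exact: cvg_cst|exact: cvg_id]].
by apply/funext => r; rewrite addr0 !mxE.
Qed.

Let f_cont w i : continuous (fun r => f r w i 0).
Proof. by apply: continuous_affine => j; exact: g_cont. Qed.

Let g_adapted : vadapted F g.
Proof.
apply: vadaptedD => //; last exact: vadapted_cst.
by apply: vadapted_mulmx.
Qed.

Let f_adapted : vadapted F f.
Proof.
apply: vadaptedD => //; last exact: vadapted_cst.
by apply: vadapted_mulmx.
Qed.

Let Lam_adapted : vadapted F Lam.
Proof.
rewrite (_ : Lam = fun t w => B *m W' t w + (- M) *m g t w +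
   (- Z) *m col_integral 0 t (g ^~ w)); last first.
  by apply/funext => t; apply/funext => w; rewrite !mulNmx.
apply: vadaptedD => //; last first.
  by apply: vadapted_mulmx => //; apply: vadapted_col_integral.
by apply: vadaptedD => //; apply: vadapted_mulmx.
Qed.

Let Lam_increment s t w : 0 <= s -> s <= t ->
  Lam t w - Lam s w =
  B *m (W' t w - W' s w) - M *m (g t w - g s w) - Z *m col_integral s t (g ^~ w).
Proof.
move=> s0 st; rewrite /Lam -(col_integralDB _ s0 st) // !mulmxBr.
move: (B *m _) (B *m _) (M *m _) (M *m _) (Z *m _) (Z *m _) => a1 a2 a3 a4 a5 a6.
by apply/colP => i; rewrite !mxE; ring.
Qed.

(** This is the bulk equation read on the wall: inserting [Lam] gives
    [dg - dLam = K dg - B dW + Z g dt], and [K dg = B dW + c K v dt] by the choice of [g]. *)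
Let f_integral s t w : 0 <= s -> s <= t ->
  col_integral s t (f ^~ w) = (g t w - g s w) - (Lam t w - Lam s w).
Proof.
move=> s0 st; rewrite Lam_increment // col_integral_affine //.
have Kg : K *m (g t w - g s w) =
    B *m (W' t w - W' s w) + (c * (t - s)) *: (K *m v).
  rewrite /g opprD addrACA -mulmxBr -scalerBl mulmxDr -scalemxAr mulmxA.
  rewrite mulKVmx //.
  by congr (_ + _ *: _); ring.
have -> : B *m (W' t w - W' s w) =
    M *m (g t w - g s w) + (g t w - g s w) - (c * (t - s)) *: (K *m v).
  by apply/eqP; rewrite eq_sym subr_eq -Kg mulmxDl mul1mx.
rewrite scalerA [_ * c]mulrC.
move: (g t w - g s w) (M *m (_ - _)) (_ *: (K *m v)) (Z *m _) => a1 a2 a3 a4.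
by apply/colP => i; rewrite !mxE; ring.
Qed.

Let dynamics : wall_fluid_dynamics ip P F L T M Z B W
  (fun t w => L (f t w)) (fun t w => L (g t w)) g Lam.
Proof.
(* By adjointness, pairing a lifted process with [h] is a fixed linear combination of its
   coordinates, which gives adaptedness. *)
have dotL (x : R -> Om -> 'cV[R]_n) h : (fun t w => ip (L (x t w)) h) =
    fun t w => \sum_i wip (T h) (delta_mx i 0) * x t w i 0.
  by apply/funext => t; apply/funext => w; rewrite (dot_lift hT) dot_colE.
split.
- by move=> h; rewrite dotL; apply: adapted_sum => // i; exact: adaptedZ.
- by move=> h; rewrite dotL; apply: adapted_sum => // i; exact: adaptedZ.
- exact: g_adapted.
- exact: Lam_adapted.
apply: aeW => w; split.
- move=> t h _; apply: integrable_continuous.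
  rewrite (_ : (fun _ => _) = fun r => wip (T h) (f r w)).
    exact: continuous_dot.
  by apply/funext => r; rewrite (dot_lift hT).
- by move=> t i _; exact: integrable_continuous.
- move=> s t h s0 st.
  rewrite -linearB (dot_lift hT).
  rewrite (@eq_Rintegral _ _ _ mu _ (fun r => wip (T h) (f r w))).
    rewrite Rintegral_dot // f_integral // (dot_lift hT) -linearDr.
    by rewrite subrK.
  by move=> r _; rewrite (dot_lift hT).
- by move=> t _; rewrite hTL.
- move=> s t s0 st; rewrite Lam_increment // /W' !max_r ?(le_trans s0) //.
  move: (Z *m _) (B *m _) (M *m _) => a1 a2 a3.
  by apply/colP => i; rewrite !mxE; ring.
Qed.

Let power00 w : wip (g 0 w) (f 0 w) = 1.
Proof.
have [_ /(_ w) W0 _ _] := hW.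
have g0 : g 0 w = v by rewrite /g /W' maxxx W0 mulmx0 add0r mulr0 addr0 scale1r.
rewrite /f g0 linearDr [X in _ + X]linearZr_LR /= /c divfK ?subrKC //.
by rewrite gt_eqF // K_gt0.
Qed.

(** Two separate times are needed: [g] is evaluated at the endpoints of a cell, [f] at the times
    inside it. The bound follows from joint continuity at [(0, 0)], with [m] depending on the
    path. *)
Let power_near0 w : exists m : nat, forall s t,
  0 <= s <= m.+1%:R^-1 -> 0 <= t <= m.+1%:R^-1 -> 1/2 <= wip (g s w) (f t w).
Proof.
have cvg_power : wip (g z.1 w) (f z.2 w)
    @[z --> filter_prod (nbhs (0 : R)) (nbhs (0 : R))] --> (1 : R).
  rewrite -(power00 w) dot_colE.
  rewrite (_ : (fun _ => _) = fun z : R * R =>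
      \sum_i wip (g z.1 w) (delta_mx i 0) * f z.2 w i 0); last first.
    by apply/funext => z; exact: dot_colE.
  apply: cvg_big => [|i _]; first exact: add_continuous.
  apply: cvgM.
    apply: (@cvg_comp _ _ _ fst (fun r => wip (g r w) (delta_mx i 0)) _ _ _
      cvg_fst).
    have := @continuous_dot _ _ wip (delta_mx i 0) _ (@g_cont w) 0.
    rewrite dotC; apply: cvg_trans; apply: near_eq_cvg; near=> r; exact: dotC.
  apply: (@cvg_comp _ _ _ snd (fun r => f r w i 0) _ _ _ cvg_snd); exact: f_cont.
have half : 1/2 < 1 :> R by lra.
have [[A C] [/= nA nC] AC] := cvgr_gt _ cvg_power _ half.
have /nbhs_ballP [e /= e0 eAC] : nbhs (0 : R) (A `&` C) by exact: filterI.
exists (Num.truncn e^-1) => s t.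
have me : (Num.truncn e^-1).+1%:R^-1 < e.
  by rewrite invf_plt ?posrE // truncnS_gt.
have inball x : 0 <= x <= (Num.truncn e^-1).+1%:R^-1 -> (A `&` C) x.
  move=> /andP[x0 xm]; apply: eAC.
  by rewrite /ball /= sub0r normrN ger0_norm // (le_lt_trans xm).
by move=> /inball[As _] /inball[_ Ct]; apply/ltW/(AC (s, t)).
Unshelve. all: by end_near. Qed.

Let difference_ge theta s t u w : 0 <= theta <= 1 -> 0 <= s -> s <= t -> t <= u ->
  (forall r r', 0 <= r <= u -> 0 <= r' <= u -> 1/2 <= wip (g r w) (f r' w)) ->
  1/2 * (t - s) <= lifting_term ip theta L (fun t w => L (g t w)) g s t w -
                   boundary_port wip theta g Lam s t w.
Proof.
move=> /andP[th0 th1] s0 st tu fg.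
(* The lifting term is the fluid power with [g] in place of [Lam], so adjointness applies; the
   difference then pairs the integrand with [dg - dLam], the integral of [f]. *)
have -> : lifting_term ip theta L (fun t w => L (g t w)) g s t w =
    fluid_power ip theta L (fun t w => L (g t w)) g s t w by [].
rewrite (fluid_powerE hT) /boundary_port /pair_differential !hTL -linearBr /=.
rewrite -f_integral // -(Rintegral_dot wip _ s t (@f_cont w)) mulrC -Rintegral_itv_cst //.
apply: le_Rintegral => //=.
- by apply: integrable_continuous; exact: cst_continuous.
- by apply: integrable_continuous; exact: continuous_dot.
move=> r; rewrite in_itv /= => /andP[sr rt].
have ru : 0 <= r <= u by rewrite (le_trans s0) // (le_trans rt).
have gs : 1/2 <= wip (g s w) (f r w) by apply: fg => //; rewrite s0 (le_trans st).
have gt : 1/2 <= wip (g t w) (f r w) by apply: fg => //; rewrite tu (le_trans s0).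
(* The weights [1 - theta] and [theta] are nonnegative with sum 1, so the bound survives the convex
   combination. *)
rewrite linearDl !linearZl_LR /=; nra.
Qed.

Lemma lifting_ne_port : exists (fq q : R -> Om -> H) (g Lam : R -> Om -> 'cV[R]_n),
  wall_fluid_dynamics ip P F L T M Z B W fq q g Lam /\
  (forall theta, 0 <= theta <= 1 ->
     ~ same_differential P (lifting_term ip theta L q g)
         (boundary_port wip theta g Lam)).
Proof.
exists (fun t w => L (f t w)), (fun t w => L (g t w)), g, Lam; split => //.
move=> theta th same.
(* The event that [g . f >= 1/2] on [0, 1/(m+1)] lies in the exceptional set
   [E m], of probability at most [2^-(m+2)]; these events cover the sample space,
   so the [E m] would have total probability at least 1. *)
have /choice[E EP] m : exists E : set Om, [/\ measurable E,
    (P E <= (1/2 / (2 ^ m.+1)%:R)%:E)%E &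
    forall w, (forall s t, 0 <= s <= m.+1%:R^-1 -> 0 <= t <= m.+1%:R^-1 ->
      1/2 <= wip (g s w) (f t w)) -> E w].
  have m0 : 0 < m.+1%:R^-1 :> R by rewrite invr_gt0.
  (* This tolerance is exactly the lower bound that [difference_ge] gives for the Riemann sums over
     [[0, 1/(m+1)]]. *)
  have e0 : 0 < 1/2 * m.+1%:R^-1 :> R by rewrite mulr_gt0.
  have d0 : 0 < 1/2 / (2 ^ m.+1)%:R :> R by rewrite !divr_gt0 // ltr0n expn_gt0.
  have [eta eta0 small] := same _ (ltW m0) _ _ e0 d0.
  have [p tp pmesh] := itv_partition_mesh_lt eta0 m0.
  have [E [mE PE smallE]] := small p tp pmesh.
  exists E; split => // w fg; apply: contrapT => /smallE; apply/negP; rewrite -leNgt.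
  apply: le_trans (ler_norm _); rewrite -sumrB.
  apply: (riemann_sum_ge (D := fun s t w => _ - _)) => // s u s0 su um.
  by apply: difference_ge => // r r' /andP[r0 ru] /andP[r'0 r'u]; apply: fg;
    rewrite ?r0 ?r'0 (le_trans _ um).
have : (P setT <= (1/2)%:E)%E.
  (* Subadditivity is applied to the measurable sets [E i], not to the events they contain. *)
  apply: (@le_trans _ _ (\sum_(0 <= i <oo) P (E i))%E).
    apply: measure_sigma_subadditive => // [i|w _]; first by have [] := EP i.
    have [m fg] := power_near0 w.
    by exists m => //; have [_ _] := EP m; apply.
  (* Geometric series: the bounds [(1/2) / 2^(i+1)] sum to at most [1/2]. *)
  apply: (le_trans _ (@epsilon_trick0 R (1/2) xpredT _)); last by lra.
  by apply: lee_nneseries => // i _; have [] := EP i.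
by rewrite probability_setT lee_fin; lra.
Qed.

End LiftingCounterexample.
Unset Implicit Arguments.

Theorem proposition7p1 (R : realType) (d : measure_display)
    (Om : measurableType d) (P : probability Om R) (F : R -> set (set Om))
    (n k : nat) (W : R -> Om -> 'cV[R]_k)
    (H : lmodType R) (ip : {dot H for idfun}) (wip : {dot 'cV[R]_n for idfun})
    (L : {linear 'cV[R]_n -> H}) (T : {linear H -> 'cV[R]_n})
    (M Z : 'M[R]_n) (B : 'M[R]_(n, k))
    (hF : filtration F) (hW : brownian_motion P F W)
    (hT : is_adjoint ip wip L T) (hTL : forall x, T (L x) = x)
    (hM : wall_positive wip M) :
  (forall (fq q : R -> Om -> H) (g Lam : R -> Om -> 'cV[R]_n),
     wall_fluid_dynamics ip P F L T M Z B W fq q g Lam ->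
     {ae P, forall w, forall s t h, 0 <= s -> s <= t ->
        fluid_reaction ip fq q s t h w =
        - ip (L (wall_reaction M Z B W g s t w)) h} /\
     (forall theta, 0 <= theta <= 1 ->
        [/\ same_differential P
              (fun s t w => fluid_power ip theta L q Lam s t w +
                            wall_power wip theta g Lam s t w)
              (pair_differential wip theta (fun t w => T (q t w) - g t w) Lam),
            same_differential P
              (pair_differential wip theta (fun t w => T (q t w) - g t w) Lam)
              (fun _ _ _ => 0),
            same_differential P (fluid_power ip theta L q Lam)
              (boundary_port wip theta g Lam),
            same_differential P (wall_power wip theta g Lam)
              (fun s t w => - boundary_port wip theta g Lam s t w)
          & coordinate_inertia ip P theta L T q g])) /\
  ((0 < n)%N ->
   exists (fq q : R -> Om -> H) (g Lam : R -> Om -> 'cV[R]_n),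
     wall_fluid_dynamics ip P F L T M Z B W fq q g Lam /\
     (forall theta, 0 <= theta <= 1 ->
        ~ same_differential P (lifting_term ip theta L q g)
            (boundary_port wip theta g Lam))).
Proof.
split=> [fq q g Lam dyn|n0].
  split; first exact: (action_reaction dyn).
  move=> theta _; split.
  - by apply: same_differential_ae; apply: aeW => w s t _ _; exact: total_powerE.
  - exact: (trace_power0 wip dyn).
  - exact: (fluid_power_port hT dyn).
  - by apply: same_differential_ae; apply: aeW.
  - exact: coordinate_inertia_lifting.
(* In positive dimension a coordinate vector serves as the nonzero direction [v]. *)
pose i := Ordinal n0.
have v0 : delta_mx i 0 != 0 :> 'cV[R]_n.
  by apply/eqP => /colP/(_ i)/eqP; rewrite !mxE !eqxx oner_eq0.
exact: (lifting_ne_port Z B hF hW hT hTL hM v0).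
Qed.
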